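(* There exists a universal constant $c>0$ such that for all $n$ and $k\in[n]$, $$\inf_{\widehat{\theta}}\sup_{\theta^*\in\Theta_{k}^{\uparrow}}\mathbb{E}\|\widehat{\theta}-\theta^*\|^2\geq \begin{cases} c\sigma^2, & k=1, \\ c\sigma^2k\log\log(16n/k), & k\geq 2, \end{cases}$$ where the infimum is over all measurable functions $\widehat\theta$ of $X$ and the expectation is under $X\sim N(\theta^*,\sigma^2 I_n)$.
   Context: $[n]=\{1,\dots,n\}$. For reals $a\le b$, $(a:b]$ is the set of integers $i$ with $a<i\le b$. For $k\in[n]$, $\Theta_k^{\uparrow}$ is the set of $\theta\in\mathbb{R}^n$ for which there exist integers $0=a_0\le a_1\le\cdots\le a_k=n$ and reals $\mu_1\le\cdots\le\mu_k$ with $\theta_i=\mu_j$ for all $i\in(a_{j-1}:a_j]$. *)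

(* Defs.v *)
From HB Require Import structures.
From mathcomp Require Import all_boot all_order all_algebra.
From mathcomp Require Import all_classical all_reals all_analysis.
Set Implicit Arguments. Unset Strict Implicit. Unset Printing Implicit Defensive.
Import Order.TTheory GRing.Theory Num.Theory.
Local Open Scope classical_set_scope.
Local Open Scope ring_scope.

(* Vectors of R^n are n.-tuple R,
   which MathComp-Analysis equips with the product sigma-algebra.          *)

Section defs.
Context {R : realType}.

(* Theta_k^up : theta in R^n that is piecewise constant with k (possibly
   empty) consecutive blocks (a_{j-1}:a_j], j = 1..k, with nondecreasing
   values mu_1 <= ... <= mu_k.  The coordinate theta_i (i in [n], 1-based)
   is tnth theta (i-1). *)
Definition Theta_up (n k : nat) (theta : n.-tuple R) : Prop :=
  exists (a : nat -> nat) (mu : nat -> R),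
    [/\ a 0%N = 0%N, a k = n,
        (forall j, (j < k)%N -> (a j <= a j.+1)%N),
        (forall j, (1 <= j < k)%N -> mu j <= mu j.+1) &
        (forall (i : 'I_n) (j : nat), (1 <= j <= k)%N ->
            (a j.-1 < i.+1 <= a j)%N -> tnth theta i = mu j)].

(* Expectation E f(X) for X ~ N(m, s^2 I_n), for nonnegative f, written as
   the iterated integral against the product of the one-dimensional normal
   laws N(m_i, s^2) (equal to the product-measure integral by Tonelli). *)
Fixpoint gauss_expect (s : R) (n : nat) : n.-tuple R -> (n.-tuple R -> \bar R) -> \bar R :=
  match n with
  | 0%N => fun _ f => f [tuple]
  | n'.+1 => fun m f =>
      (\int[normal_prob (thead m) s]_x
         gauss_expect s (behead_tuple m) (fun t => f (cons_tuple x t)))%E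
  end.

Definition sqdist (n : nat) (u v : n.-tuple R) : R :=
  \sum_(i < n) (tnth u i - tnth v i) ^+ 2.

Definition gauss_risk (s : R) (n : nat) (thetahat : n.-tuple R -> n.-tuple R)
    (theta : n.-tuple R) : \bar R :=
  gauss_expect s theta (fun x => (sqdist (thetahat x) theta)%:E).

End defs.

(* Main.v *)
Require Import Defs.
From HB Require Import structures.
From mathcomp Require Import all_boot all_order all_algebra.
From mathcomp Require Import all_classical all_reals all_analysis.
From mathcomp Require Import measurable_realfun ring lra zify.
Import Order.TTheory GRing.Theory Num.Theory.
Local Open Scope classical_set_scope.
Local Open Scope ring_scope.

(* A finite family th_j of means at squared distance at most (log M)/2 * s^2 from
   a common base point, at pairwise squared distance at least 4r, has average
   risk at least r/8: writing L_j for the likelihood ratios against the base law,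
   at most one th_j is at squared distance below r from the estimator at each
   sample point, and AM-GM at that index costs
   only t/2 * E L_j^2 + 1/(2t), where E L_j^2 = exp(|th_j - base|^2 / s^2).

   For k >= 2, cut [n] into k/2 blocks of length m.  Inside a block the hypotheses
   raise the last 2^j coordinates (2^j <= m) by h / sqrt(2^j): each has squared
   norm h^2 and two of them are h^2/2 apart, so log2 m hypotheses are available
   per block and h^2 may be of order s^2 log log m.  Shifting block b by b * h
   keeps the signal monotone, and averaging over all choices of (j_b)_b adds the
   bounds of the separate blocks.  For k = 1 two constant signals suffice. *)

(** * Calculus of the iterated Gaussian expectation *)

Section gauss.
Context {R : realType}.
Implicit Types (m s : R) (n : nat).
Local Notation mu := (@lebesgue_measure R).

(** The Radon-Nikodym derivative of the normal law and [normal_pdf] have the same integral over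
    every measurable set, so they agree almost everywhere. *)
Lemma ge0_integral_normal_prob m s (f : R -> \bar R) :
  measurable_fun setT f -> (forall x, 0 <= f x)%E ->
  (\int[normal_prob m s]_x f x = \int[mu]_x (f x * (normal_pdf m s x)%:E))%E.
Proof.
move=> mf f0.
have dom := normal_prob_dominates m s.
rewrite -(Radon_Nikodym_SigmaFinite.change_of_variables dom)//.
have mg : measurable_fun setT
    (Radon_Nikodym_SigmaFinite.f (normal_prob m s) mu).
  exact: measurable_int (Radon_Nikodym_SigmaFinite.f_integrable dom).
have mp : measurable_fun setT (EFin \o normal_pdf m s).
  by apply/measurable_EFinP; exact: measurable_normal_pdf.
apply: ae_eq_integral => //; [exact: emeasurable_funM|exact: emeasurable_funM|].
apply: ae_eqe_mul2l => /=; apply: integral_ae_eq => //=.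
  exact: (Radon_Nikodym_SigmaFinite.f_integrable dom).
move=> E _ mE; rewrite -(Radon_Nikodym_SigmaFinite.f_integral dom)//.
Qed.

Lemma gauss_expect_ge0 s n (m : n.-tuple R) (f : n.-tuple R -> \bar R) :
  (forall x, 0 <= f x)%E -> (0 <= gauss_expect s m f)%E.
Proof.
elim: n m f => [|n IH] m f f0 /=; first exact: f0.
by apply: integral_ge0 => x _; apply: IH => t; exact: f0.
Qed.

(** The free parameter is what makes the induction on [n] work: the head coordinate joins the
    parameter, so the induction hypothesis is used on [Y * R], and Tonelli then integrates that
    coordinate out. *)
Lemma measurable_gauss_expect_param s n (m : n.-tuple R) d
    (Y : measurableType d) (f : Y * n.-tuple R -> \bar R) :
  measurable_fun setT f -> (forall z, 0 <= f z)%E ->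
  measurable_fun setT (fun y => gauss_expect s m (fun t => f (y, t))).
Proof.
elim: n m d Y f => [|n IH] m d Y f mf f0 /=.
  exact: (measurableT_comp mf (measurable_fun_pair _ _)).
pose F (z : Y * R) := gauss_expect s (behead_tuple m)
  (fun t => f (z.1, cons_tuple z.2 t)).
apply: (@measurable_fun_fubini_tonelli_F _ _ _ _ _ (normal_prob (thead m) s) F).
  apply: (IH _ _ _ (fun z : (Y * R) * n.-tuple R =>
    f (z.1.1, cons_tuple z.1.2 z.2))) => //.
  apply: measurableT_comp mf _ => /=.
  apply: measurable_fun_pair.
    exact: measurableT_comp.
  apply: (@measurable_cons _ _ _ _ (fun z : (Y * R) * n.-tuple R => z.1.2)) => //.
  exact: measurableT_comp.
by move=> z; apply: gauss_expect_ge0 => t.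
Qed.

Lemma measurable_cons_tuple n x :
  measurable_fun setT (fun t : n.-tuple R => cons_tuple x t).
Proof. exact: (@measurable_cons _ _ _ _ (fun=> x)). Qed.

Lemma measurable_gauss_expect_cons s n (m : n.-tuple R)
    (f : n.+1.-tuple R -> \bar R) :
  measurable_fun setT f -> (forall z, 0 <= f z)%E ->
  measurable_fun setT (fun x => gauss_expect s m (fun t => f (cons_tuple x t))).
Proof.
move=> mf f0.
apply: (@measurable_gauss_expect_param s n m _ _
  (fun z : R * n.-tuple R => f (cons_tuple z.1 z.2))) => //.
by apply: measurableT_comp mf _; exact: measurable_cons.
Qed.

Lemma eq_gauss_expect s n (m : n.-tuple R) (f g : n.-tuple R -> \bar R) :
  f =1 g -> gauss_expect s m f = gauss_expect s m g.
Proof. by move=> /funext ->. Qed.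

Lemma le_gauss_expect s n (m : n.-tuple R) (f g : n.-tuple R -> \bar R) :
  measurable_fun setT f -> (forall z, 0 <= f z)%E ->
  measurable_fun setT g -> (forall z, f z <= g z)%E ->
  (gauss_expect s m f <= gauss_expect s m g)%E.
Proof.
elim: n m f g => [|n IH] m f g mf f0 mg fg /=; first exact: fg.
have g0 z : (0 <= g z)%E by exact: le_trans (fg z).
apply: ge0_le_integral => //.
- by move=> x _; exact: gauss_expect_ge0.
- exact: measurable_gauss_expect_cons.
- exact: measurable_gauss_expect_cons.
- move=> x _; apply: IH => //.
    exact: measurableT_comp mf (measurable_cons_tuple _ x).
  exact: measurableT_comp mg (measurable_cons_tuple _ x).
Qed.

Lemma gauss_expectD s n (m : n.-tuple R) (f g : n.-tuple R -> \bar R) :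
  measurable_fun setT f -> (forall z, 0 <= f z)%E ->
  measurable_fun setT g -> (forall z, 0 <= g z)%E ->
  (gauss_expect s m (fun z => f z + g z) =
   gauss_expect s m f + gauss_expect s m g)%E.
Proof.
elim: n m f g => [|n IH] m f g mf f0 mg g0 //=.
rewrite -ge0_integralD//.
- apply: eq_integral => x _; apply: IH => //.
    exact: measurableT_comp mf (measurable_cons_tuple _ x).
  exact: measurableT_comp mg (measurable_cons_tuple _ x).
- by move=> x _; exact: gauss_expect_ge0.
- exact: measurable_gauss_expect_cons.
- by move=> x _; exact: gauss_expect_ge0.
- exact: measurable_gauss_expect_cons.
Qed.

Lemma gauss_expectZ s n (m : n.-tuple R) c (f : n.-tuple R -> \bar R) :
  0 <= c -> measurable_fun setT f -> (forall z, 0 <= f z)%E ->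
  (gauss_expect s m (fun z => c%:E * f z) = c%:E * gauss_expect s m f)%E.
Proof.
move=> c0; elim: n m f => [|n IH] m f mf f0 //=.
rewrite -ge0_integralZl//.
- apply: eq_integral => x _; apply: IH => //.
  exact: measurableT_comp mf (measurable_cons_tuple _ x).
- exact: measurable_gauss_expect_cons.
- by move=> x _; exact: gauss_expect_ge0.
Qed.

Lemma gauss_expect_cst s n (m : n.-tuple R) (c : R) :
  0 <= c -> gauss_expect s m (fun=> c%:E) = c%:E.
Proof.
move=> c0; elim: n m => [|n IH] m //=.
under eq_integral do rewrite IH.
by rewrite integral_cst//= probability_setT mule1.
Qed.

Lemma gauss_expect_sum s n (m : n.-tuple R) (I : Type) (r : seq I)
    (f : I -> n.-tuple R -> \bar R) :
  (forall i, measurable_fun setT (f i)) -> (forall i z, 0 <= f i z)%E ->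
  (gauss_expect s m (fun z => \sum_(i <- r) f i z) =
   \sum_(i <- r) gauss_expect s m (f i))%E.
Proof.
move=> mf f0; elim: r => [|i r IH].
  rewrite big_nil -[RHS](gauss_expect_cst s n m 0)//.
  by apply: eq_gauss_expect => z; rewrite big_nil.
under eq_fun do rewrite big_cons; rewrite big_cons.
rewrite gauss_expectD ?IH//.
  exact: emeasurable_sum.
by move=> z; exact: sume_ge0.
Qed.

(** * Gaussian likelihood ratios and their second moments *)

Definition lratio s (a b x : R) : R :=
  expR (((b - a) * (x - a) - (b - a) ^+ 2 / 2) / s ^+ 2).

Lemma normal_pdf_lratio s a b x : 0 < s ->
  normal_pdf b s x = lratio s a b x * normal_pdf a s x.
Proof.
move=> s0; rewrite !normal_pdfE ?gt_eqF// mulrCA; congr (_ * _).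
rewrite /normal_fun /lratio -expRD; congr expR.
by field; rewrite gt_eqF.
Qed.

(** Squaring an exponential tilt doubles it, which is again a tilt, now towards the reflected mean
    [2 * b - a], up to a constant. The second moment thus reduces to a total mass. *)
Lemma lratio_sqr s a b x : 0 < s ->
  lratio s a b x ^+ 2 =
  expR ((b - a) ^+ 2 / s ^+ 2) * lratio s a (2 * b - a) x.
Proof.
move=> s0; rewrite /lratio -expRM_natl -expRD; congr expR.
by field; rewrite gt_eqF.
Qed.

Lemma measurable_lratio s a b : measurable_fun setT (lratio s a b).
Proof.
apply: measurableT_comp => //; apply: measurable_funM => //.
apply: measurable_funB => //; apply: measurable_funM => //.
exact: measurable_funB.
Qed.

Lemma normal_change_mean s a b (f : R -> \bar R) : 0 < s ->
  measurable_fun setT f -> (forall x, 0 <= f x)%E ->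
  (\int[normal_prob b s]_x f x =
   \int[normal_prob a s]_x ((lratio s a b x)%:E * f x))%E.
Proof.
move=> s0 mf f0.
have mL : measurable_fun setT (fun x => ((lratio s a b x)%:E * f x)%E).
  apply: emeasurable_funM => //; apply/measurable_EFinP.
  exact: measurable_lratio.
have L0 x : (0 <= (lratio s a b x)%:E * f x)%E.
  by rewrite mule_ge0// lee_fin expR_ge0.
rewrite (ge0_integral_normal_prob _ _ _ mf f0).
rewrite (ge0_integral_normal_prob _ _ _ mL L0).
apply: eq_integral => x _.
by rewrite (normal_pdf_lratio s a)// EFinM muleA (muleC (f x)).
Qed.

Definition likelihood s n (a b x : n.-tuple R) : R :=
  \prod_(i < n) lratio s (tnth a i) (tnth b i) (tnth x i).

Lemma likelihood_ge0 s n (a b x : n.-tuple R) : 0 <= likelihood s n a b x.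
Proof. by apply: prodr_ge0 => i _; exact: expR_ge0. Qed.

Lemma measurable_likelihood s n (a b : n.-tuple R) :
  measurable_fun setT (likelihood s n a b).
Proof.
apply: measurable_prod => i _.
exact: measurableT_comp (measurable_lratio _ _ _) (measurable_tnth i).
Qed.

Lemma likelihood_cons s n (a b : n.+1.-tuple R) x t :
  likelihood s n.+1 a b (cons_tuple x t) =
  lratio s (thead a) (thead b) x *
  likelihood s n (behead_tuple a) (behead_tuple b) t.
Proof.
rewrite /likelihood big_ord_recl; congr (_ * _).
apply: eq_bigr => i _; rewrite tnthS !tnth_behead.
have -> // : inord i.+1 = lift ord0 i.
by apply/val_inj; rewrite /= inordK ?ltnS.
Qed.

Lemma gauss_change_mean s n (a b : n.-tuple R) (f : n.-tuple R -> \bar R) :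
  0 < s -> measurable_fun setT f -> (forall x, 0 <= f x)%E ->
  (gauss_expect s b f =
   gauss_expect s a (fun x => (likelihood s n a b x)%:E * f x))%E.
Proof.
move=> s0; elim: n a b f => [|n IH] a b f mf f0 /=.
  by rewrite /likelihood big_ord0 mul1e.
rewrite (normal_change_mean s (thead a))//; first last.
- by move=> x; exact: gauss_expect_ge0.
- exact: measurable_gauss_expect_cons.
apply: eq_integral => x _.
have mfx : measurable_fun setT (fun t => f (cons_tuple x t)).
  exact: measurableT_comp mf (measurable_cons_tuple _ x).
rewrite (IH (behead_tuple a))//.
rewrite -gauss_expectZ ?expR_ge0//.
- apply: eq_gauss_expect => t.
  by rewrite likelihood_cons EFinM muleA.
- apply: emeasurable_funM => //.
  by apply/measurable_EFinP; exact: measurable_likelihood.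
- by move=> z; rewrite mule_ge0// lee_fin likelihood_ge0.
Qed.

Lemma gauss_expect_likelihood s n (a b : n.-tuple R) : 0 < s ->
  gauss_expect s a (fun x => (likelihood s n a b x)%:E) = 1%E.
Proof.
move=> s0; rewrite -[RHS](gauss_expect_cst s n b 1)// [RHS](gauss_change_mean s n a)//.
by apply: eq_gauss_expect => x; rewrite mule1.
Qed.

(** Coordinatewise reflection turns the squared ratio into a constant times the likelihood ratio of
    the mean [b'], whose expectation is 1. *)
Lemma gauss_expect_likelihood_sqr s n (a b : n.-tuple R) : 0 < s ->
  gauss_expect s a (fun x => (likelihood s n a b x ^+ 2)%:E) =
  (expR (sqdist b a / s ^+ 2))%:E.
Proof.
move=> s0.
pose b' := [tuple 2 * tnth b i - tnth a i | i < n].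
transitivity (gauss_expect s a (fun x =>
    ((expR (sqdist b a / s ^+ 2))%:E * (likelihood s n a b' x)%:E)%E)).
  apply: eq_gauss_expect => x; rewrite -EFinM; congr EFin.
  rewrite /likelihood -prodrXl /sqdist mulr_suml expR_sum -big_split/=.
  by apply: eq_bigr => i _; rewrite lratio_sqr// tnth_mktuple.
rewrite gauss_expectZ ?expR_ge0//.
- by rewrite gauss_expect_likelihood// mule1.
- by apply/measurable_EFinP; exact: measurable_likelihood.
- by move=> z; rewrite lee_fin likelihood_ge0.
Qed.

End gauss.

(** * Risk bound for a finite family of separated means *)

Section testing.
Context {R : realType}.

(** The loss is restricted to a set of coordinates so that each block can be bounded separately and
    the bounds added. *)
Definition sqdist_on n (P : pred 'I_n) (u v : n.-tuple R) : R :=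
  \sum_(i < n | P i) (tnth u i - tnth v i) ^+ 2.

Lemma sqdist_on_ge0 n (P : pred 'I_n) (u v : n.-tuple R) :
  0 <= sqdist_on n P u v.
Proof. by apply: sumr_ge0 => i _; exact: sqr_ge0. Qed.

(** In each coordinate the right side exceeds the left by the square [(2 * x - y - z) ^+ 2]. *)
Lemma sqdist_on_triangle n (P : pred 'I_n) (u v w : n.-tuple R) :
  sqdist_on n P v w <= 2 * (sqdist_on n P u v + sqdist_on n P u w).
Proof.
rewrite /sqdist_on -big_split mulr_sumr; apply: ler_sum => i _ /=.
set x := tnth u i; set y := tnth v i; set z := tnth w i.
have := sqr_ge0 (2 * x - y - z); nra.
Qed.

Lemma measurable_sqdist_on n (P : pred 'I_n) (f : n.-tuple R -> n.-tuple R)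
    (v : n.-tuple R) :
  measurable_fun setT f -> measurable_fun setT (fun x => sqdist_on n P (f x) v).
Proof.
move=> mf; rewrite /sqdist_on; under eq_fun do rewrite big_mkcond/=.
apply: measurable_sum => i; case: (P i) => //.
apply: measurable_funX; apply: measurable_funB => //.
exact: measurableT_comp (measurable_tnth i) mf.
Qed.

(* AM-GM is applied only at the (at most one) index whose [d] is below [r]. *)
Lemma separated_likelihood_bound (I : finType) (L d : I -> R) (r t : R) :
  0 <= r -> 0 < t -> (forall j, 0 <= L j) -> (forall j, 0 <= d j) ->
  (forall j l, j != l -> r <= d j \/ r <= d l) ->
  r * \sum_j L j <=
  \sum_j L j * d j + (r * t / 2) * (\sum_j L j ^+ 2) + r / (2 * t).
Proof.
move=> r0 t0 L0 d0 sep.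
have q0 : 0 <= r / (2 * t) by rewrite divr_ge0// mulr_ge0// ltW.
have p0 : 0 <= r * t / 2 by rewrite divr_ge0// mulr_ge0// ltW.
case: (pickP (fun j => d j < r)) => [j0 dj0|H]; last first.
  have Le : r * \sum_j L j <= \sum_j L j * d j.
    rewrite mulr_sumr; apply: ler_sum => j _; rewrite mulrC ler_wpM2l//.
    by rewrite leNgt; apply/negP => dj; have := H j; rewrite /= dj.
  have S0 : 0 <= \sum_j L j ^+ 2 by apply: sumr_ge0 => j _; exact: sqr_ge0.
  have := mulr_ge0 p0 S0; lra.
rewrite [\sum_j L j](bigD1 j0)//= [\sum_j L j * d j](bigD1 j0)//=.
rewrite [\sum_j L j ^+ 2](bigD1 j0)//=.
have Le : r * \sum_(j | j != j0) L j <= \sum_(j | j != j0) L j * d j.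
  rewrite mulr_sumr; apply: ler_sum => j jj0; rewrite mulrC ler_wpM2l//.
  by case: (sep _ _ jj0) => // ; rewrite leNgt dj0.
have S0 : 0 <= \sum_(j | j != j0) L j ^+ 2.
  by apply: sumr_ge0 => j _; exact: sqr_ge0.
have T0 := mulr_ge0 p0 S0.
have U0 := mulr_ge0 (L0 j0) (d0 j0).
have amgm : r * L j0 <= r * t / 2 * L j0 ^+ 2 + r / (2 * t).
  have -> : r * t / 2 * L j0 ^+ 2 + r / (2 * t) =
      r * L j0 + r / (2 * t) * (t * L j0 - 1) ^+ 2.
    by field; rewrite gt_eqF.
  by rewrite lerDl mulr_ge0// sqr_ge0.
rewrite !mulrDr; lra.
Qed.

Variables (s : R) (n : nat).
Hypothesis s0 : 0 < s.

(** The pointwise bound is integrated under the base mean [a]: each ratio has mean 1, its square has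
    mean at most [expR D], and ratio times loss integrates to the risk under [th j]. *)
Lemma sum_risk_ge (I : finType) (P : pred 'I_n) (a : n.-tuple R)
    (th : I -> n.-tuple R) (est : n.-tuple R -> n.-tuple R) (D r t : R) :
  measurable_fun setT est -> 0 <= r -> 0 < t ->
  (forall j, sqdist (th j) a <= D * s ^+ 2) ->
  (forall j l, j != l -> 4 * r <= sqdist_on n P (th j) (th l)) ->
  ((r * (#|I|%:R * (1 - t / 2 * expR D) - (2 * t)^-1))%:E <=
   \sum_j gauss_expect s (th j) (fun x => (sqdist_on n P (est x) (th j))%:E))%E.
Proof.
move=> mest r0 t0 near sep.
set S := (\sum_j _)%E.
pose L j x := likelihood s n a (th j) x.
pose d j x := sqdist_on n P (est x) (th j).
have mL j : measurable_fun setT (L j) by exact: measurable_likelihood.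
have md j : measurable_fun setT (d j) by exact: measurable_sqdist_on.
have L0 j x : 0 <= L j x by exact: likelihood_ge0.
have d0 j x : 0 <= d j x by exact: sqdist_on_ge0.
have pt x := separated_likelihood_bound I (L ^~ x) (d ^~ x) r t r0 t0
  (L0 ^~ x) (d0 ^~ x).
have {}pt x : r * \sum_j L j x <= \sum_j L j x * d j x +
    (r * t / 2) * (\sum_j L j x ^+ 2) + r / (2 * t).
  apply: pt => j l jl.
  have := sqdist_on_triangle n P (est x) (th j) (th l).
  have := sep j l jl; rewrite -/(d j x) -/(d l x) => h1 h2.
  (* Separation and the triangle bound give [2 * r <= d j x + d l x], so the two losses cannot both
     be below [r]. *)
  by have [|] := lerP r (d j x); [left|right; lra].
have lhs : gauss_expect s a (fun x => (r * \sum_j L j x)%:E) =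
    (r * #|I|%:R)%:E.
  transitivity (r%:E * \sum_(j : I) gauss_expect s a (fun x => (L j x)%:E))%E.
    rewrite -gauss_expect_sum; first last.
    - by move=> j x; rewrite lee_fin.
    - by move=> j; apply/measurable_EFinP.
    rewrite -gauss_expectZ//.
    - by apply: eq_gauss_expect => x; rewrite EFinM sumEFin.
    - by apply: emeasurable_sum => j; apply/measurable_EFinP.
    - by move=> x; apply: sume_ge0 => j _; rewrite lee_fin.
  under eq_bigr do rewrite gauss_expect_likelihood//.
  by rewrite sumEFin sumr_const EFinM.
have sq0 : 0 <= r * t / 2 by rewrite divr_ge0// mulr_ge0// ltW.
have sq : (gauss_expect s a (fun x => (r * t / 2 * (\sum_j L j x ^+ 2))%:E) <=
    (r * t / 2 * (#|I|%:R * expR D))%:E)%E.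
  have -> : gauss_expect s a (fun x => (r * t / 2 * (\sum_j L j x ^+ 2))%:E) =
      ((r * t / 2)%:E *
       \sum_(j : I) gauss_expect s a (fun x => (L j x ^+ 2)%:E))%E.
    rewrite -gauss_expect_sum; first last.
    - by move=> j x; rewrite lee_fin sqr_ge0.
    - by move=> j; apply/measurable_EFinP; apply: measurable_funX.
    rewrite -gauss_expectZ//.
    - by apply: eq_gauss_expect => x; rewrite EFinM sumEFin.
    - apply: emeasurable_sum => j; apply/measurable_EFinP.
      exact: measurable_funX.
    - by move=> x; apply: sume_ge0 => j _; rewrite lee_fin sqr_ge0.
  rewrite [leRHS]EFinM lee_wpmul2l// ?lee_fin//.
  under eq_bigr do rewrite gauss_expect_likelihood_sqr//.
  rewrite sumEFin lee_fin mulr_natl -sumr_const; apply: ler_sum => j _.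
  by rewrite ler_expR ler_pdivrMr ?exprn_gt0.
have rk : gauss_expect s a (fun x => (\sum_j L j x * d j x)%:E) = S.
  rewrite /S; under [RHS]eq_bigr => j _.
    rewrite (gauss_change_mean s n a)//; first last.
    - by move=> x; rewrite lee_fin; exact: d0.
    - by apply/measurable_EFinP; exact: md.
    over.
  rewrite -gauss_expect_sum; first last.
  - by move=> j x; rewrite -EFinM lee_fin mulr_ge0// ?L0 ?d0.
  - move=> j; apply: emeasurable_funM; apply/measurable_EFinP.
      exact: mL.
    exact: md.
  by apply: eq_gauss_expect => x; rewrite -sumEFin; apply: eq_bigr.
have m1 : measurable_fun setT (fun x => \sum_j L j x * d j x).
  by apply: measurable_sum => j; exact: measurable_funM.
have m2 : measurable_fun setT (fun x => r * t / 2 * (\sum_j L j x ^+ 2)).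
  apply: measurable_funM => //; apply: measurable_sum => j.
  exact: measurable_funX.
have p1 x : 0 <= \sum_j L j x * d j x.
  by apply: sumr_ge0 => j _; rewrite mulr_ge0.
have p2 x : 0 <= r * t / 2 * (\sum_j L j x ^+ 2).
  by rewrite mulr_ge0//; apply: sumr_ge0 => j _; exact: sqr_ge0.
have p3 : 0 <= r / (2 * t) by rewrite divr_ge0// mulr_ge0// ltW.
have main : ((r * #|I|%:R)%:E <=
    S + (r * t / 2 * (#|I|%:R * expR D))%:E + (r / (2 * t))%:E)%E.
  rewrite -lhs -rk.
  apply: (@le_trans _ _ (gauss_expect s a (fun x =>
    (\sum_j L j x * d j x)%:E + (r * t / 2 * (\sum_j L j x ^+ 2))%:E
      + (r / (2 * t))%:E)%E)).
    apply: le_gauss_expect.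
    - apply/measurable_EFinP; apply: measurable_funM => //.
      exact: measurable_sum.
    - by move=> x; rewrite lee_fin mulr_ge0//; apply: sumr_ge0.
    - apply: emeasurable_funD => //; apply: emeasurable_funD;
      exact/measurable_EFinP.
    - by move=> x; rewrite -!EFinD lee_fin.
  rewrite gauss_expectD//; first last.
  - by move=> x; rewrite -EFinD lee_fin addr_ge0.
  - by apply: emeasurable_funD; exact/measurable_EFinP.
  rewrite gauss_expect_cst// leeD2r// gauss_expectD//; first by rewrite leeD2l.
  - exact/measurable_EFinP.
  - exact/measurable_EFinP.
(* Only real terms are moved to the other side, so [S] may be infinite. *)
rewrite -addeA -EFinD in main.
have -> : r * (#|I|%:R * (1 - t / 2 * expR D) - (2 * t)^-1) =
  r * #|I|%:R - (r * t / 2 * (#|I|%:R * expR D) + r / (2 * t)).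
  by field; rewrite gt_eqF.
by rewrite EFinB leeBlDr.
Qed.

Lemma average_risk_ge (I : finType) (P : pred 'I_n) (a : n.-tuple R)
    (th : I -> n.-tuple R) (est : n.-tuple R -> n.-tuple R) (r : R) :
  measurable_fun setT est -> 0 <= r -> (2 <= #|I|)%N ->
  (forall j, sqdist (th j) a <= ln #|I|%:R / 2 * s ^+ 2) ->
  (forall j l, j != l -> 4 * r <= sqdist_on n P (th j) (th l)) ->
  ((#|I|%:R * (r / 8))%:E <=
   \sum_j gauss_expect s (th j) (fun x => (sqdist_on n P (est x) (th j))%:E))%E.
Proof.
move=> mest r0 I2 near sep.
have I0 : 0 < #|I|%:R :> R by rewrite ltr0n; exact: leq_trans I2.
pose z : R := expR (ln #|I|%:R / 4).
have z0 : 0 < z by exact: expR_gt0.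
have zE : z ^+ 4 = #|I|%:R.
  rewrite -expRM_natl mulrCA divff ?mulr1 ?lnK ?posrE//.
have z2E : expR (ln #|I|%:R / 2) = z ^+ 2.
  by rewrite -expRM_natl; congr expR; field.
(* the weight t = z^-3 balances the two error terms, each equal to 1/(2z) *)
apply: le_trans (sum_risk_ge _ P a th est (ln #|I|%:R / 2) r (z ^- 3) mest r0 _ near sep).
  rewrite lee_fin z2E -zE.
  have -> : r * (z ^+ 4 * (1 - z ^- 3 / 2 * z ^+ 2) - (2 * z ^- 3)^-1) =
      z ^+ 4 * (r * (1 - z^-1)).
    by field; rewrite gt_eqF.
  rewrite ler_wpM2l ?exprn_ge0 ?(ltW z0)//; apply: ler_wpM2l => //.
  (* Since [(8 / 7) ^+ 4 < 2] and [z ^+ 4] is the cardinal, at least 2, the factor [1 - z^-1] is at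
     least 1/8. *)
  have z87 : 8 / 7 <= z.
    rewrite leNgt; apply/negP => zlt.
    have : z ^+ 4 < (8 / 7) ^+ 4 by rewrite ltrXn2r// ?ltW//; lra.
    have : 2 <= #|I|%:R :> R by rewrite ler_nat.
    rewrite zE => h1 h2; have : 2 < (8/7)^+4 :> R by exact: le_lt_trans h1 h2.
    rewrite !exprS expr0; lra.
  have : z^-1 <= (8 / 7)^-1 by rewrite lef_pV2// posrE; lra.
  by rewrite invf_div; lra.
by rewrite invr_gt0 exprn_gt0.
Qed.

End testing.

(** * Averaging over independent choices in the blocks *)

Section block_average.
Context {R : realType} (T I : finType).
Implicit Types (J : {ffun T -> I}) (b : T) (j : I).

Definition upd J b j : {ffun T -> I} := [ffun b' => if b' == b then j else J b'].

(** Exchanging the new value [j] with the old value [J b] is an involution on pairs, so resampling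
    one coordinate preserves the uniform law on choices. *)
Lemma sum_upd b (f : {ffun T -> I} -> R) :
  \sum_J \sum_j f (upd J b j) = #|I|%:R * \sum_J f J.
Proof.
pose h (p : {ffun T -> I} * I) := (upd p.1 b p.2, p.1 b).
have hK : involutive h.
  case=> J j; rewrite /h /=; congr pair; last by rewrite ffunE eqxx.
  by apply/ffunP => b'; rewrite !ffunE; case: eqP => // ->.
rewrite (pair_bigA _ (fun J j => f (upd J b j)))/=.
transitivity (\sum_p f (h p).1); first by [].
rewrite -(reindex_inj (P := predT) (F := fun p => f p.1) (inv_inj hK))/=.
rewrite -(pair_bigA _ (fun J _ => f J))/=.
by rewrite mulr_sumr; apply: eq_bigr => J _; rewrite sumr_const mulr_natl.
Qed.

(** Sum over all [J]: by resampling coordinate [b], the hypothesis [lb] bounds the average of [f b]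
    below by [v]. Exchanging the two sums then adds these bounds over [b]. *)
Lemma block_average_real (f : T -> {ffun T -> I} -> R) (v s : R) :
  (0 < #|I|)%N ->
  (forall b J, #|I|%:R * v <= \sum_j f b (upd J b j)) ->
  (forall J, \sum_b f b J <= s) -> #|T|%:R * v <= s.
Proof.
move=> I0 lb ub.
set N : R := #|{ffun T -> I}|%:R.
have N0 : 0 < N by rewrite ltr0n card_ffun expn_gt0 I0.
have key b : N * v <= \sum_J f b J.
  have I0' : 0 < #|I|%:R :> R by rewrite ltr0n.
  rewrite -(ler_pM2l I0') -(sum_upd b) mulrCA.
  by rewrite {1}/N mulr_natl -sumr_const; apply: ler_sum.
rewrite -(ler_pM2l N0); apply: (@le_trans _ _ (\sum_J \sum_b f b J)).
  rewrite exchange_big/= mulrCA mulr_natl -sumr_const.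
  exact: ler_sum.
by rewrite /N mulr_natl -sumr_const; apply: ler_sum.
Qed.

Lemma block_average (F : T -> {ffun T -> I} -> \bar R) (v : R) (S : \bar R) :
  (0 < #|I|)%N -> (forall b J, 0 <= F b J)%E ->
  (forall b J, (#|I|%:R * v)%:E <= \sum_j F b (upd J b j))%E ->
  (forall J, \sum_b F b J <= S)%E -> ((#|T|%:R * v)%:E <= S)%E.
Proof.
move=> I0 F0 lb ub.
(* One choice exists, which excludes [S] equal to minus infinity; if [S] is real, nonnegativity
   makes every [F b J] finite. *)
have [i0 _] : exists i0 : I, i0 \in I by apply/card_gt0P.
have S0 : (0 <= S)%E.
  by apply: le_trans (ub [ffun=> i0]); exact: sume_ge0.
case: S S0 ub => [s| |//] _ ub; last by rewrite leey.
have Ffin b J : F b J = (fine (F b J))%:E.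
  rewrite fineK// ge0_fin_numE//; apply: le_lt_trans (ltry s).
  apply: le_trans (ub J); rewrite (bigD1 b)//= leeDl//.
  exact: sume_ge0.
rewrite lee_fin; apply: (block_average_real (fun b J => fine (F b J))) => //.
  move=> b J; rewrite -lee_fin -sumEFin; under eq_bigr do rewrite -Ffin.
  exact: lb.
by move=> J; rewrite -lee_fin -sumEFin; under eq_bigr do rewrite -Ffin.
Qed.

End block_average.

(** * The hypotheses: monotone staircases with one optional jump position per block *)

Section staircase.
Context {R : realType}.
Variables (B m o M : nat) (h : R).
Hypothesis m0 : (0 < m)%N.
Hypothesis h0 : 0 <= h.
Hypothesis pow_le : forall j : 'I_M, (2 ^ j <= m)%N.
Let n := (o + B.+1 * m)%N.
Implicit Types (J : {ffun 'I_B.+1 -> 'I_M}) (i : 'I_n) (b : 'I_B.+1) (j l : 'I_M).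

Definition block (i : nat) := ((i - o) %/ m)%N.

Definition step_height (j : nat) : R := h / Num.sqrt (2 ^+ j).

(* The first block absorbs the [o] leftover coordinates; truncated subtraction
   in [block] places them in block 0, and they are never raised. *)
Definition raised (b j i : nat) := (o + b.+1 * m <= i + 2 ^ j)%N.

Definition staircase J : n.-tuple R :=
  [tuple (block i)%:R * h + (if raised (block i) (J (inord (block i))) i
                             then step_height (J (inord (block i))) else 0)
   | i < n].

(** This is the base point of the likelihood ratios for block [b]. It does not depend on [J b], and
    it agrees with all the competing hypotheses outside the block. *)
Definition staircase_flat J (b : nat) : n.-tuple R :=
  [tuple if block i == b then (block i)%:R * h else tnth (staircase J) i
   | i < n].

Lemma block_eq (i b : nat) :
  (block i == b) = (b * m <= i - o < b.+1 * m)%N.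
Proof.
by rewrite eqn_leq -[(block i <= b)%N]ltnS /block ltn_divLR// leq_divRL// andbC.
Qed.

Lemma block_lt i : (block i < B.+1)%N.
Proof.
by clear h0; rewrite /block ltn_divLR//; have := ltn_ord i; rewrite /n; lia.
Qed.

Lemma step_height_sqr j : step_height j ^+ 2 = h ^+ 2 / 2 ^+ j.
Proof. by rewrite expr_div_n sqr_sqrtr// exprn_ge0. Qed.

Lemma step_height_ge0 j : 0 <= step_height j.
Proof. by rewrite divr_ge0// sqrtr_ge0. Qed.

Lemma step_height_le j : step_height j <= h.
Proof.
rewrite ler_pdivrMr ?sqrtr_gt0 ?exprn_gt0// ler_peMr//.
by rewrite -[leLHS]sqrtr1 ler_sqrt ?exprn_ge0// exprn_ege1// ler1n.
Qed.

Lemma sum_interval (x y : nat) (c : R) : (y <= n)%N ->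
  \sum_(i < n | (x <= i < y)%N) c = (y - x)%:R * c.
Proof.
move=> yn; rewrite -(big_mkord (fun i : nat => (x <= i < y)%N) (fun=> c)).
rewrite mulr_natl -sumr_const_nat (big_nat_widenl x 0)//.
by rewrite (big_nat_widen 0 y n).
Qed.

Lemma staircase_upd J b j i : tnth (staircase (upd _ _ J b j)) i =
  if block i == b :> nat
  then b%:R * h + (if raised b j i then step_height j else 0)
  else tnth (staircase J) i.
Proof.
rewrite !tnth_mktuple; case: eqP => [->|bi].
  by rewrite inord_val ffunE eqxx.
rewrite ffunE; case: eqP => // ib; case: bi.
by rewrite -ib inordK ?block_lt.
Qed.

Lemma tnth_staircase_flat J b i : tnth (staircase_flat J b) i =
  if block i == b :> nat then b%:R * h else tnth (staircase J) i.
Proof. by rewrite tnth_mktuple; case: eqP => // ->. Qed.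

Lemma raised_interval b j i : block i = b -> raised b j i =
  (o + b.+1 * m - 2 ^ j <= i < o + b.+1 * m)%N.
Proof.
move=> /eqP; rewrite block_eq /raised => /andP[h1 h2].
rewrite leq_subLR [(2 ^ j + i)%N]addnC.
have -> : (i < o + b.+1 * m)%N by lia.
by rewrite andbT.
Qed.

Lemma interval_block b j i :
  (o + b.+1 * m - 2 ^ j <= i < o + b.+1 * m)%N -> block i = b.
Proof.
move=> /andP[h1 h2]; apply/eqP; rewrite block_eq.
have := pow_le j; move: h1 h2; rewrite mulSn; lia.
Qed.

Lemma block_end_le b : (o + b.+1 * m <= n)%N.
Proof. by rewrite /n leq_add2l leq_mul2r ltn_ord orbT. Qed.

(** The two differ at exactly [2 ^ j] coordinates, each time by [h / sqrt (2 ^ j)]. *)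
Lemma sqdist_staircase_flat J b j :
  sqdist (staircase (upd _ _ J b j)) (staircase_flat J b) = h ^+ 2.
Proof.
transitivity (\sum_(i < n | (o + b.+1 * m - 2 ^ j <= i < o + b.+1 * m)%N)
    step_height j ^+ 2).
  rewrite [RHS]big_mkcond; apply: eq_bigr => i _.
  rewrite staircase_upd tnth_staircase_flat.
  have [bi|bi] := eqVneq (block i) b.
    rewrite raised_interval// addrC addKr.
    by case: ifP => //; rewrite expr0n.
  rewrite subrr expr0n/=; case: ifP => // /interval_block ib.
  by rewrite ib eqxx in bi.
rewrite sum_interval ?block_end_le// step_height_sqr.
rewrite subKn; last by rewrite mulSn; have := pow_le j; lia.
by rewrite natrX; field; rewrite expf_neq0.
Qed.

(** On the coordinates raised for [l] but not for [j] the gap is [step_height l]. There are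
    [2 ^ l - 2 ^ j] of them, at least half of [2 ^ l]. *)
Lemma sqdist_on_staircase_lt J b j l : (j < l)%N ->
  h ^+ 2 / 2 <= sqdist_on n (fun i => block i == b)
    (staircase (upd _ _ J b j)) (staircase (upd _ _ J b l)).
Proof.
move=> jl; rewrite /sqdist_on.
pose Q i := (o + b.+1 * m - 2 ^ l <= i < o + b.+1 * m - 2 ^ j)%N.
have pjl : (2 ^ j.+1 <= 2 ^ l)%N by rewrite leq_exp2l.
have pl := pow_le l.
have QP i : Q i -> block i = b.
  move=> /andP[h1 h2]; apply: (@interval_block _ l); rewrite h1/=.
  exact: leq_trans h2 (leq_subr _ _).
apply: (@le_trans _ _ (\sum_(i < n | Q i) step_height l ^+ 2)).
  rewrite sum_interval; last exact: leq_trans (leq_subr _ _) (block_end_le b).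
  have -> : (o + b.+1 * m - 2 ^ j - (o + b.+1 * m - 2 ^ l) = 2 ^ l - 2 ^ j)%N.
    by move: pl; rewrite mulSn; move: pjl; rewrite expnS; lia.
  rewrite step_height_sqr mulrCA ler_wpM2l ?sqr_ge0//.
  rewrite ler_pdivlMr ?exprn_gt0// mulrC ler_pdivrMr// -natrX -natrM ler_nat.
  by move: pjl; rewrite expnS; lia.
rewrite [leRHS]big_mkcond [leLHS]big_mkcond/=; apply: ler_sum => i _.
case: ifPn => [Qi|_]; last by case: ifP => // _; exact: sqr_ge0.
have bi := QP i Qi; rewrite bi eqxx !staircase_upd bi eqxx !raised_interval//.
move: Qi => /andP[h1 h2].
rewrite h1 (leq_trans h2 (leq_subr _ _)) [(_ <= i)%N]leqNgt h2/= addr0.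
by rewrite opprD addrA subrr sub0r sqrrN.
Qed.

Lemma sqdist_on_staircase J b j l : j != l ->
  h ^+ 2 / 2 <= sqdist_on n (fun i => block i == b)
    (staircase (upd _ _ J b j)) (staircase (upd _ _ J b l)).
Proof.
rewrite -val_eqE/= neq_ltn => /orP[|] jl; first exact: sqdist_on_staircase_lt.
apply: le_trans (sqdist_on_staircase_lt J b l j jl) _.
by rewrite le_eqVlt; apply/orP; left; apply/eqP; apply: eq_bigr => i _;
  rewrite -sqrrN opprB.
Qed.

Lemma sqdist_blocks (u v : n.-tuple R) :
  sqdist u v = \sum_(b < B.+1) sqdist_on n (fun i => block i == b) u v.
Proof.
rewrite /sqdist (partition_big (fun i => inord (block i) : 'I_B.+1) predT)//=.
apply: eq_bigr => b _; apply: eq_bigl => i.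
by rewrite -val_eqE/= inordK ?block_lt.
Qed.

(** Each of the [k./2] blocks uses two pieces, a flat one and a raised one; for odd [k] the last
    piece is empty. *)
Lemma Theta_up_staircase k J : k./2 = B.+1 -> Theta_up k (staircase J).
Proof.
move=> kB.
(* Index [2b] is the start of block [b] and index [2b+1] the start of its raised part. The value 0
   at index 0 puts the leftover coordinates in the first piece, and all indices from [2(B+1)] on
   give [n]. *)
pose a (j : nat) := if (B.+1.*2 <= j)%N then n else if odd j then
  (o + j./2.+1 * m - 2 ^ J (inord j./2))%N
  else if j == 0%N then 0%N else (o + j./2 * m)%N.
(* Pieces count from 1, hence the predecessor: [2b+1] is the flat piece of block [b] and [2b+2] the
   raised one. *)
pose mu (j : nat) : R := j.-1./2%:R * h +
  if odd j then 0 else step_height (J (inord j.-1./2)).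
have aeven (b : nat) : (0 < b <= B.+1)%N -> a b.*2 = (o + b * m)%N.
  move=> /andP[b0 bB]; rewrite /a leq_double odd_double doubleK double_eq0.
  rewrite eqn0Ngt b0 /=; case: ltnP => // Bb.
  by rewrite /n; congr (_ + _ * _)%N; apply/eqP; rewrite eqn_leq Bb.
have aodd (b : nat) : (b < B.+1)%N ->
    a b.*2.+1 = (o + b.+1 * m - 2 ^ J (inord b))%N.
  by move=> bB; rewrite /a ifF /= ?odd_double /= ?uphalf_double//; lia.
exists a, mu; split.
- by rewrite /a.
- by rewrite /a ifT//; lia.
- move=> j jk; have := odd_double_half j; case: (odd j) => /= <-; set b := j./2.
  + rewrite add1n -doubleS.
    have [bB|bB] := ltnP b B.+1; last first.
      by rewrite /a !ifT// ?leq_double//; lia.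
    by rewrite aodd// aeven//; rewrite leq_subr.
  + rewrite add0n.
    have [bB|bB] := ltnP b B.+1; last first.
      by rewrite /a !ifT// ?leq_double//; lia.
    rewrite aodd//; have := pow_le (J (inord b)).
    case: b bB => [|b] bB pl; first by rewrite /a.
    rewrite aeven; last by rewrite /= ltnW.
    by move: (2 ^ _)%N pl => q pl; rewrite [(b.+2 * m)%N]mulSn; lia.
- move=> j /andP[j1 jk]; rewrite /mu; case: j j1 jk => // j _ jk /=.
  rewrite uphalf_half; case: (odd j) => /=; rewrite ?add0n ?add1n addr0.
  (* From a raised piece to the next block: the base level grows by [h], which is at least the
     jump. *)
  + rewrite -natr1 mulrDl mul1r lerD2l; exact: step_height_le.
  + by rewrite lerDl step_height_ge0.
- move=> i j /andP[j1 jk] /andP[]; rewrite ltnS.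
  have [b jE] : exists b : nat, j = b.*2.+1 \/ j = b.*2.+2.
    exists j.-1./2; have := odd_double_half j.-1; case: (odd _) => /= E; lia.
  have bB : (b <= B.+1)%N by lia.
  move: bB; rewrite leq_eqVlt => /orP[/eqP bE|bB].
    (* The extra piece of an odd [k] starts at [n] and contains no coordinate. *)
    have -> : a j.-1 = n by rewrite /a ifT//; lia.
    by move=> ni; have := ltn_ord i; rewrite ltnNge ni.
  case: jE => -> /=; rewrite tnth_mktuple.
  + rewrite aodd// => ia ib.
    have bi : block i = b.
      apply/eqP; rewrite block_eq; have := pow_le (J (inord b)).
      have : (0 < 2 ^ J (inord b))%N by rewrite expn_gt0.
      move: (2 ^ _)%N ib => q ib q0 qm.
      case: b ia ib bB => [|b] ia ib bB; first by lia.
      by move: ia; rewrite aeven; [lia|rewrite /= ltnW].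
    rewrite bi /mu /= odd_double /= doubleK /raised ifF//; lia.
  + rewrite aodd// -doubleS aeven// => ia ib.
    have bi : block i = b.
      apply: (@interval_block (Ordinal bB) (J (inord b)) i).
      by rewrite /= ia.
    by rewrite bi /mu /= odd_double /= uphalf_double /raised ifT//; lia.
Qed.

End staircase.

(** * Minimax lower bounds for several pieces and for one piece *)

Section minimax.
Context {R : realType}.

(** The jump lengths 1, 2, 4, ... up to [m] give [M] hypotheses per block. Their separation
    [h ^+ 2 / 2] is [4 * r] with [r = h ^+ 2 / 8], so each block contributes [h ^+ 2 / 64]. *)
Lemma multi_step_risk_ge (s : R) (B m o k : nat)
    (est : (o + B.+1 * m).-tuple R -> (o + B.+1 * m).-tuple R) :
  0 < s -> (2 <= m)%N -> k./2 = B.+1 -> measurable_fun setT est ->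
  ((B.+1%:R * (s ^+ 2 * ln (trunc_log 2 m).+1%:R / 128))%:E <=
   ereal_sup [set gauss_risk s est theta | theta in Theta_up k])%E.
Proof.
move=> s0 m2 kB mest.
set M := (trunc_log 2 m).+1.
have m0 : (0 < m)%N by exact: leq_trans m2.
have M2 : (2 <= M)%N by rewrite /M ltnS trunc_log_gt0.
have pow_le (j : 'I_M) : (2 ^ j <= m)%N.
  apply: leq_trans (trunc_logP (ltnSn 1) m0).
  by rewrite leq_exp2l// -ltnS ltn_ord.
have lnM0 : 0 <= ln M%:R :> R by rewrite ln_ge0// ler1n.
(* This is the largest [h] that the distance condition of [average_risk_ge] permits. *)
pose h : R := s * Num.sqrt (ln M%:R / 2).
have h0 : 0 <= h by rewrite mulr_ge0 ?sqrtr_ge0 ?(ltW s0).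
have h2 : h ^+ 2 = ln M%:R / 2 * s ^+ 2.
  by rewrite exprMn sqr_sqrtr ?divr_ge0// mulrC.
pose th := staircase B m o M h.
pose P (b : 'I_B.+1) (i : 'I_(o + B.+1 * m)) := block m o i == b.
pose F b J := gauss_expect s (th J)
  (fun x => (sqdist_on _ (P b) (est x) (th J))%:E).
have -> : B.+1%:R * (s ^+ 2 * ln M%:R / 128) =
    #|'I_B.+1|%:R * (h ^+ 2 / 8 / 8).
  by rewrite card_ord h2; field.
apply: (block_average 'I_B.+1 'I_M F).
- by rewrite card_ord.
- move=> b J; apply: gauss_expect_ge0 => x.
  by rewrite lee_fin sqdist_on_ge0.
- move=> b J.
  apply: (average_risk_ge s _ s0 _ (P b) (staircase_flat B m o M h J b)
    (fun j => th (upd _ _ J b j))) => //.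
  + by rewrite divr_ge0// sqr_ge0.
  + by rewrite card_ord.
  + by move=> j; rewrite sqdist_staircase_flat// card_ord h2.
  + move=> j l jl.
    apply: le_trans (sqdist_on_staircase _ _ _ _ _ m0 h0 pow_le J b j l jl).
    by lra.
- move=> J; apply: (@le_trans _ _ (gauss_risk s est (th J))).
    rewrite /F -gauss_expect_sum.
    + rewrite le_eqVlt; apply/orP; left; apply/eqP; apply: eq_gauss_expect => x.
      by rewrite sumEFin (sqdist_blocks B m o m0).
    + by move=> b; apply/measurable_EFinP; exact: measurable_sqdist_on.
    + by move=> b x; rewrite lee_fin sqdist_on_ge0.
  apply: ereal_sup_ubound; exists (th J) => //.
  exact: Theta_up_staircase.
Qed.

Lemma Theta_up_const n (x : R) : Theta_up 1 [tuple x | _ < n].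
Proof.
exists (fun j => if j == 0%N then 0%N else n), (fun=> x); split=> //.
- by case=> // j /andP[].
- by move=> i j _ _; rewrite tnth_mktuple.
Qed.

(** The two constant signals 0 and [x] are tested against each other with 0 as base point. The type
    [unit] makes this the one-block case of the averaging argument. *)
Lemma one_piece_risk_ge (s : R) n (est : n.-tuple R -> n.-tuple R) :
  0 < s -> (0 < n)%N -> measurable_fun setT est ->
  ((s ^+ 2 * ln 2 / 64)%:E <=
   ereal_sup [set gauss_risk s est theta | theta in Theta_up 1])%E.
Proof.
move=> s0 n0 mest.
have n0' : 0 < n%:R :> R by rewrite ltr0n.
have ln20 : 0 <= ln 2 :> R by rewrite ln_ge0// ler1n.
pose x : R := s * Num.sqrt (ln 2 / 2 / n%:R).
have x2 : n%:R * x ^+ 2 = ln 2 / 2 * s ^+ 2.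
  rewrite exprMn sqr_sqrtr ?divr_ge0//.
  by field; rewrite gt_eqF.
pose th (J : {ffun unit -> bool}) : n.-tuple R := [tuple if J tt then x else 0 | _ < n].
have dist (J J' : {ffun unit -> bool}) : J tt != J' tt ->
    sqdist_on n predT (th J) (th J') = ln 2 / 2 * s ^+ 2.
  move=> JJ'; rewrite -x2 /sqdist_on.
  under eq_bigr do rewrite !tnth_mktuple.
  rewrite sumr_const card_ord mulr_natl; congr (_ *+ _).
  by move: JJ'; do 2 case: (_ tt) => //; rewrite ?subr0// sub0r sqrrN.
pose F (_ : unit) J := gauss_expect s (th J)
  (fun x => (sqdist_on n predT (est x) (th J))%:E).
have -> : s ^+ 2 * ln 2 / 64 = #|{: unit}|%:R * (ln 2 / 2 * s ^+ 2 / 4 / 8).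
  by rewrite card_unit; field.
apply: (block_average unit bool F).
- by rewrite card_bool.
- by move=> b J; apply: gauss_expect_ge0 => z; rewrite lee_fin sqdist_on_ge0.
- move=> b J.
  apply: (average_risk_ge s _ s0 _ predT (th [ffun=> false])
    (fun j => th (upd _ _ J b j))) => //.
  + by have := sqr_ge0 s; nra.
  + by rewrite card_bool.
  + move=> [|]; rewrite card_bool.
      have := dist (upd _ _ J b true) [ffun=> false].
      rewrite !ffunE; case: b => /= /(_ isT) <-.
      by [].
    rewrite /sqdist big1; first by have := sqr_ge0 s; nra.
    move=> i _.
    by rewrite !tnth_mktuple !ffunE; case: b => /=; rewrite subrr expr0n.
  + move=> j l jl; rewrite dist; last by case: b; rewrite !ffunE.
    by lra.
- move=> J; apply: (@le_trans _ _ (gauss_risk s est (th J))).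
    by rewrite big_const card_unit /= adde0.
  apply: ereal_sup_ubound; exists (th J) => //.
  exact: Theta_up_const.
Qed.

(** The argument is at most [2 ^+ (M + 3)], so its logarithm is at most [M + 3], which is at most
    [M ^ 3] once [M] is at least 2. *)
Lemma ln_ln_le (n k M : nat) : (0 < k <= n)%N -> (2 <= M)%N ->
  (16 * n <= k * 2 ^ (M + 3))%N ->
  ln (ln (16 * n%:R / k%:R)) <= 3 * ln M%:R :> R.
Proof.
move=> /andP[k0 kn] M2 le.
have k0' : 0 < k%:R :> R by rewrite ltr0n.
have M0 : 0 < M%:R :> R by rewrite ltr0n; lia.
set x : R := _ / _.
have x1 : 1 < x.
  rewrite ltr_pdivlMr// mul1r -natrM ltr_nat.
  by have := leq_trans k0 kn; lia.
have lx : x <= 2 ^+ (M + 3).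
  by rewrite ler_pdivrMr// -natrX -!natrM ler_nat mulnC [(_ * k)%N]mulnC mulnC.
have lnx0 : 0 < ln x by rewrite ln_gt0.
have ln2 : ln 2 <= 1 :> R.
  by have := le_ln1Dx (x := 1 : R); rewrite -[1 + 1]/2; apply; lra.
have lnx : ln x <= M%:R ^+ 3.
  apply: (@le_trans _ _ (ln (2 ^+ (M + 3)))).
    by rewrite ler_ln// posrE ?exprn_gt0//; apply: lt_trans x1.
  rewrite lnXn//; apply: (@le_trans _ _ (1 *+ (M + 3))).
    by rewrite lerMn2r ln2 orbT.
  rewrite -natrX ler_nat; nia.
apply: (@le_trans _ _ (ln (M%:R ^+ 3))).
  by rewrite ler_ln// posrE exprn_gt0.
by rewrite lnXn// mulr_natl.
Qed.

End minimax.

Theorem mainTheorem3 (R : realType) :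
  exists c : R, 0 < c /\
  forall (n k : nat), (1 <= k <= n)%N ->
  forall sigma : R, 0 < sigma ->
  forall thetahat : n.-tuple R -> n.-tuple R, measurable_fun setT thetahat ->
    ((if k == 1%N then c * sigma ^+ 2
      else c * sigma ^+ 2 * k%:R * ln (ln (16 * n%:R / k%:R)))%:E
     <= ereal_sup [set gauss_risk sigma thetahat theta | theta in Theta_up k])%E.
Proof.
(* The 128 comes from the block bound, one factor 3 from [ln_ln_le], the other from comparing [k]
   with the number of blocks. *)
exists ((9 * 128)^-1); split; first by rewrite invr_gt0 mulr_gt0.
move=> n k /andP[k1 kn] s s0 est mest.
have s2 : 0 <= s ^+ 2 by exact: sqr_ge0.
case: eqP => [k1'|/eqP k1'].
  rewrite k1' in kn *.
  apply: le_trans (one_piece_risk_ge s n est s0 kn mest).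
  (* This follows from [ln (1 - 1/2) <= - 1/2]. *)
  have ln2 : 1 / 2 <= ln 2 :> R.
    have := le_ln1Dx (x := - (1 / 2) : R); have -> : 1 - 1 / 2 = 2^-1 :> R by lra.
    rewrite lnV ?posrE// => /(_ _); lra.
  rewrite lee_fin; nra.
have k2 : (2 <= k)%N by lia.
have [B BE] : exists B, k./2 = B.+1 by exists k./2.-1; lia.
have [m [q [nE qB]]] : exists m q, n = (q + B.+1 * m)%N /\ (q < B.+1)%N.
  exists (n %/ B.+1)%N, (n %% B.+1)%N; split; last by rewrite ltn_mod.
  by rewrite addnC mulnC -divn_eq.
subst n.
(* Here [n >= k >= 2(B+1)], while the remainder [q] is below [B+1]. *)
have m2 : (2 <= m)%N by nia.
apply: le_trans (multi_step_risk_ge s B m q k est s0 m2 BE mest).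
set M := (trunc_log 2 m).+1.
have mM : (m < 2 ^ M)%N by exact: trunc_log_ltn.
have M2 : (2 <= M)%N by rewrite /M ltnS trunc_log_gt0.
(* As [q < B+1] and [m < 2 ^ M], the dimension is below [(B+1) * 2 ^ M], and [2(B+1) <= k]. *)
have le : (16 * (q + B.+1 * m) <= k * 2 ^ (M + 3))%N.
  rewrite expnD; move: (2 ^ M)%N mM => p mp; nia.
have lnln := @ln_ln_le R _ k M (introT andP (conj k1 kn)) M2 le.
have lnM0 : 0 <= ln M%:R :> R by rewrite ln_ge0// ler1n.
rewrite lee_fin.
apply: (@le_trans _ _ ((9 * 128)^-1 * s ^+ 2 * k%:R * (3 * ln M%:R))).
  by apply: ler_wpM2l => //; do 2 rewrite mulr_ge0//.
(* Halving loses at most one: [k <= 2(B+1) + 1]. *)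
have k3 : k%:R <= 3 * B.+1%:R :> R by rewrite -natrM ler_nat; lia.
have -> : (9 * 128)^-1 * s ^+ 2 * k%:R * (3 * ln M%:R) =
  (s ^+ 2 * ln M%:R / (3 * 128)) * k%:R by field.
have -> : B.+1%:R * (s ^+ 2 * ln M%:R / 128) =
  (s ^+ 2 * ln M%:R / (3 * 128)) * (3 * B.+1%:R) by field.
by rewrite ler_wpM2l//; apply: divr_ge0 => //; apply: mulr_ge0.
Qed.
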